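(* Let $1\le p\le n$, let $\widetilde G:St^n_p\to\mathbb R$ be a smooth function and let $G:\mathbb R^{np}\to\mathbb R$ be a smooth extension, $\widetilde G=G_{|St^n_p}$. A matrix $U\in\mathcal M_{n\times p}(\mathbb R)$ with columns $\mathbf u_1,\dots,\mathbf u_p$ is a critical point of $\widetilde G$ (in particular $U\in St_p^n$) if and only if the following conditions are simultaneously satisfied, where $\mathbf u=\mathrm{vec}(U)$: (i) $\left\langle\frac{\partial G}{\partial\mathbf u_c}(\mathbf u),\mathbf u_b\right\rangle=\left\langle\frac{\partial G}{\partial\mathbf u_b}(\mathbf u),\mathbf u_c\right\rangle$ for all $1\le b<c\le p$; (ii) $\frac{\partial G}{\partial\mathbf u_a}(\mathbf u)\in\mathrm{Span}\{\mathbf u_1,\dots,\mathbf u_p\}$ for all $1\le a\le p$; (iii) $U^TU=\mathbb I_p$.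
   Context: $St_p^n=\{U\in\mathcal M_{n\times p}(\mathbb R)\mid U^TU=\mathbb I_p\}$ is the orthogonal Stiefel manifold. A matrix $U$ with columns $\mathbf u_1,\dots,\mathbf u_p\in\mathbb R^n$ is identified with $\mathbf u=\mathrm{vec}(U)=(\mathbf u_1^T,\dots,\mathbf u_p^T)\in\mathbb R^{np}$; via this identification $St^n_p\subset\mathbb R^{np}$. $\frac{\partial G}{\partial\mathbf u_a}(\mathbf u)\in\mathbb R^n$ is the vector of partial derivatives of $G$ with respect to the entries of $\mathbf u_a$. *)

(* Defs.v *)
From HB Require Import structures.
From mathcomp Require Import all_boot all_order all_algebra.
From mathcomp Require Import all_classical all_reals all_analysis.

Set Implicit Arguments.
Unset Strict Implicit.
Unset Printing Implicit Defensive.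

Import Order.TTheory GRing.Theory Num.Theory.
Import numFieldNormedType.Exports.

Local Open Scope classical_set_scope.
Local Open Scope ring_scope.

(* In finite dimension, testing the differential on every vector v amounts to
   asking that x |-> 'd f x be C^k as a map into linear maps. *)
Fixpoint Ck_on (R : realType) (V W : normedModType R) (k : nat) (O : set V)
    (f : V -> W) : Prop :=
  if k is k'.+1 then
    (forall x, O x -> differentiable f x) /\
    (forall v : V, Ck_on k' O (fun x => 'D_v f x))
  else forall x, O x -> {for x, continuous f}.

(* The set O is meant to be open. *)
Definition smooth_on (R : realType) (V W : normedModType R) (O : set V)
    (f : V -> W) : Prop :=
  forall k, Ck_on k O f.

Definition stiefel (R : realType) (n p : nat) : Type :=
  {U : 'M[R]_(n, p) | U^T *m U == 1%:M}.

(* mxvec concatenates rows, hence the transpose: vec U concatenates the columns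
   of U, and U i a is the entry of vec U of index mxvec_index a i. *)
Definition vec (R : realType) (n p : nat) (U : 'M[R]_(n, p)) : 'rV[R]_(p * n) :=
  mxvec U^T.

(* Smoothness on an embedded submanifold: locally the restriction of a smooth
   function defined on an open subset of the ambient space. *)
Definition stiefel_smooth (R : realType) (n p : nat)
    (Gt : stiefel R n p -> R) : Prop :=
  forall X : stiefel R n p,
    exists (O : set 'rV[R]_(p * n)) (F : 'rV[R]_(p * n) -> R),
      [/\ open O, O (vec (sval X)), smooth_on O F &
          forall Y : stiefel R n p, O (vec (sval Y)) -> Gt Y = F (vec (sval Y))].

(* The tangent vectors at X are the velocities g'(0) of the smooth curves g in
   the manifold with g(0) = X, and the differential of Gt at X maps g'(0) to
   (Gt o g)'(0); X is critical when this differential vanishes.  The values of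
   g outside ]-e, e[ are irrelevant. *)
Definition critical_point (R : realType) (n p : nat) (Gt : stiefel R n p -> R)
    (X : stiefel R n p) : Prop :=
  forall (g : R -> stiefel R n p) (e : R), 0 < e ->
    smooth_on [set t : R | - e < t < e] (fun t => vec (sval (g t))) ->
    g 0 = X ->
    is_derive (0 : R) (1 : R) (fun t => Gt (g t)) 0.

Definition partial_col (R : realType) (n p : nat) (G : 'rV[R]_(p * n) -> R)
    (a : 'I_p) (u : 'rV[R]_(p * n)) : 'cV[R]_n :=
  \col_(i < n) 'D_(delta_mx 0 (mxvec_index a i)) G u.

Definition inner (R : realType) (n : nat) (x y : 'cV[R]_n) : R :=
  \sum_(i < n) x i 0 * y i 0.

(* Main.v *)
(* Let M be the n x p matrix whose columns are the partial gradients of G at U.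
   The differential of G at U maps V to tr (M^T V), and the velocities V of the
   curves in the manifold satisfy V^T U = - U^T V.

   If M = U S with S symmetric, then tr (M^T V) = tr (S U^T V) is the trace of
   a symmetric times an antisymmetric matrix, hence it vanishes.  Conditions
   (i)-(iii) say exactly this, with S = U^T M.

   Conversely, if U is critical, two families of curves suffice: rotating u_b
   into u_c in their common plane gives (M^T U)_bc = (M^T U)_cb, and rotating
   u_a towards a unit vector w orthogonal to all the u_b gives <M_a, w> = 0;
   taking for w the normalized component of M_a orthogonal to the u_b shows
   that this component vanishes. *)

Require Import Defs.
From HB Require Import structures.
From mathcomp Require Import all_boot all_order all_algebra.
From mathcomp Require Import all_classical all_reals all_analysis.

Set Implicit Arguments.
Unset Strict Implicit.
Unset Printing Implicit Defensive.

Import Order.TTheory GRing.Theory Num.Theory.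
Import numFieldNormedType.Exports.

Local Open Scope classical_set_scope.
Local Open Scope ring_scope.

(** * Curves that are affine in cosine and sine *)

Section TrigonometricCurve.
Variables (R : realType) (W : normedModType R).

Lemma is_diff_trig_curve (A B C : W) (t : R) :
  is_diff t (fun s => cos s *: A + sin s *: B + C)
    (fun v => v *: (cos t *: B - sin t *: A)).
Proof.
have dc : is_diff t (fun s : R => cos s *: A) (fun v => (v * - sin t) *: A).
  have dcos : differentiable (@cos R) t by exact/derivable1_diffP.
  apply: DiffDef; first exact: differentiableZl.
  by rewrite diffZl // diff1E // derive1E derive_val.
have ds : is_diff t (fun s : R => sin s *: B) (fun v => (v * cos t) *: B).
  have dsin : differentiable (@sin R) t by exact/derivable1_diffP.
  apply: DiffDef; first exact: differentiableZl.
  by rewrite diffZl // diff1E // derive1E derive_val.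
have dC : is_diff t (fun=> C : W) (fun=> 0) by exact: is_diff_cst.
apply: is_diff_eq (is_diffD (is_diffD dc ds) dC) _.
apply/funext => v; rewrite !fctE addr0 mulrN scaleNr scalerBr !scalerA.
by rewrite addrC.
Qed.

Lemma derive_trig_curve (A B C : W) (t v : R) :
  'D_v (fun s => cos s *: A + sin s *: B + C) t =
  v *: (cos t *: B - sin t *: A).
Proof.
by have d := is_diff_trig_curve A B C t; rewrite deriveE // diff_val.
Qed.

(** Differentiating along [v] turns the coefficients [A], [B], [C] into [v *: B], [- v *: A], [0].
    The family is thus closed under derivation, and the induction on [k] ranges over all
    coefficients. *)
Lemma smooth_trig_curve (O : set R) (A B C : W) :
  smooth_on O (fun s => cos s *: A + sin s *: B + C).
Proof.
move=> k; elim: k A B C => [|k IH] A B C /=.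
  move=> t _; apply: differentiable_continuous.
  by have := is_diff_trig_curve A B C t.
split=> [t _|v]; first by have := is_diff_trig_curve A B C t.
have -> : (fun t => 'D_v (fun s : R => cos s *: A + sin s *: B + C) t) =
    (fun t => cos t *: (v *: B) + sin t *: (- v *: A) + 0).
  apply/funext => t; rewrite derive_trig_curve addr0 scalerBr !scalerA.
  by rewrite mulrN scaleNr [cos t * v]mulrC [sin t * v]mulrC.
exact: IH.
Qed.

End TrigonometricCurve.

(** * The differential as a trace pairing with the gradient matrix *)

Section Gradient.
Variables (R : realType) (n p : nat).
Implicit Types (G : 'rV[R]_(p * n) -> R) (U V : 'M[R]_(n, p)).

Lemma vecE U a i : vec U 0 (mxvec_index a i) = U i a.
Proof. by rewrite mxvecE mxE. Qed.

Lemma vec_sum_delta V :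
  vec V = \sum_a \sum_i V i a *: delta_mx 0 (mxvec_index a i).
Proof.
rewrite /vec {1}[V^T]matrix_sum_delta linear_sum; apply: eq_bigr => a _.
rewrite linear_sum; apply: eq_bigr => i _.
by rewrite linearZ /= mxvec_delta mxE.
Qed.

Definition gradmx G (u : 'rV[R]_(p * n)) : 'M[R]_(n, p) :=
  \matrix_(i, a) 'D_(delta_mx 0 (mxvec_index a i)) G u.

Lemma col_gradmx G u a : col a (gradmx G u) = partial_col G a u.
Proof. by apply/colP => i; rewrite !mxE. Qed.

Lemma diff_vec G u V : differentiable G u ->
  'd G u (vec V) = \tr ((gradmx G u)^T *m V).
Proof.
move=> dG; rewrite vec_sum_delta linear_sum; apply: eq_bigr => a _.
rewrite linear_sum mxE; apply: eq_bigr => i _.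
by rewrite linearZ /= !mxE deriveE // mulrC.
Qed.

End Gradient.

(** * Orthonormal frames moving along a curve *)

Section OrthonormalCurves.
Variables (R : realType) (n p : nat).
Implicit Types (U V B : 'M[R]_(n, p)) (Q : 'M[R]_p).

(* Both families of curves have this form: Q projects onto the coordinates of
   the columns of U that move. *)
Lemma rotation_orthonormal U B Q t :
  U^T *m U = 1%:M -> Q^T = Q -> Q *m Q = Q -> B^T *m B = Q ->
  (B^T *m U)^T = - (B^T *m U) -> B^T *m U *m Q = B^T *m U ->
  let X := cos t *: (U *m Q) + sin t *: B + U *m (1%:M - Q) in
  X^T *m X = 1%:M.
Proof.
move=> UU QT QQ BB KT KQ X.
have QC : Q *m (1%:M - Q) = 0 by rewrite mulmxBr mulmx1 QQ subrr.
have CQ : (1%:M - Q) *m Q = 0 by rewrite mulmxBl mul1mx QQ subrr.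
have CC : (1%:M - Q) *m (1%:M - Q) = 1%:M - Q.
  by rewrite mulmxBr CQ subr0 mulmx1.
have CT : (1%:M - Q)^T = 1%:M - Q by rewrite linearB /= trmx1 QT.
have KC : B^T *m U *m (1%:M - Q) = 0 by rewrite mulmxBr mulmx1 KQ subrr.
have UBE : U^T *m B = - (B^T *m U) by rewrite -KT trmx_mul trmxK.
have QK : Q *m (B^T *m U) = B^T *m U.
  apply: trmx_inj; rewrite trmx_mul QT KT mulNmx KQ //.
have CK : (1%:M - Q) *m (B^T *m U) = 0 by rewrite mulmxBl mul1mx QK subrr.
(* Block products of the three terms of [X], with [K = B^T *m U]: the squares are [Q], [Q] and
   [1%:M - Q], and the cross products vanish except [- K] and [K], whose multiples by
   [cos t * sin t] cancel. *)
have AA : (U *m Q)^T *m (U *m Q) = Q.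
  by rewrite trmx_mul QT mulmxA -(mulmxA Q) UU mulmx1.
have AB : (U *m Q)^T *m B = - (B^T *m U).
  by rewrite trmx_mul QT -mulmxA UBE mulmxN QK.
have BA : B^T *m (U *m Q) = B^T *m U by rewrite mulmxA KQ.
have AC : (U *m Q)^T *m (U *m (1%:M - Q)) = 0.
  by rewrite trmx_mul QT mulmxA -(mulmxA Q) UU mulmx1.
have CA : (U *m (1%:M - Q))^T *m (U *m Q) = 0.
  by rewrite trmx_mul CT mulmxA -(mulmxA _ U^T) UU mulmx1.
have CCE : (U *m (1%:M - Q))^T *m (U *m (1%:M - Q)) = 1%:M - Q.
  by rewrite trmx_mul CT mulmxA -(mulmxA _ U^T) UU mulmx1.
have BC : B^T *m (U *m (1%:M - Q)) = 0 by rewrite mulmxA.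
have CB : (U *m (1%:M - Q))^T *m B = 0.
  by rewrite trmx_mul CT -mulmxA UBE mulmxN CK oppr0.
rewrite {}/X; move: AA AB BA AC CA CCE BC CB.
move: (U *m Q) (U *m (1%:M - Q)) => A C AA AB BA AC CA CCE BC CB.
have -> : (cos t *: A + sin t *: B + C)^T =
    cos t *: A^T + sin t *: B^T + C^T by rewrite !raddfD /= !linearZ.
rewrite !mulmxDl !mulmxDr -!(scalemxAl, scalemxAr).
rewrite AA AB AC BA BB BC CA CB CCE !scaler0 !addr0 !add0r !scalerN.
rewrite !scalerA [sin t * cos t]mulrC.
rewrite [_ - _ + _]addrA subrK -scalerDl -!expr2 cos2Dsin2 scale1r.
by rewrite addrC subrK.
Qed.

(** The entries of [(g t)^T *m g t] are constant in [t], so the product rule makes the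
    symmetrization of [(g 0)^T *m V] vanish. *)
Lemma tangent_antisym (g : R -> 'M[R]_(n, p)) V :
  (forall t, (g t)^T *m g t = 1%:M) ->
  is_derive (0 : R) (1 : R) (fun t => vec (g t)) (vec V) ->
  V^T *m g 0 = - ((g 0)^T *m V).
Proof.
move=> og dg.
have dgi i a : is_derive (0 : R) (1 : R) (fun t => g t i a) (V i a).
  have dgv : derivable (fun t => vec (g t)) 0 1 by exact: ex_derive.
  have := derive_mx dgv; rewrite derive_val.
  move/matrixP/(_ 0 (mxvec_index a i)); rewrite vecE mxE.
  have /derivable_mxP/(_ 0 (mxvec_index a i)) := dgv.
  under eq_fun do rewrite vecE.
  move=> ? ->; exact: derivableP.
apply/matrixP => b c; apply/eqP; rewrite !mxE -subr_eq0 opprK.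
have : is_derive (0 : R) (1 : R) (fun t => ((g t)^T *m g t) b c)
    (\sum_i (g 0 i b *: V i c + g 0 i c *: V i b)).
  have -> : (fun t => ((g t)^T *m g t) b c) =
      \sum_(i < n) ((fun t => g t i b) * (fun t => g t i c)).
    apply/funext => t; rewrite mxE fct_sumE; apply: eq_bigr => i _.
    by rewrite mxE.
  by apply: is_derive_sum => i; exact: is_deriveM.
have -> : (fun t => ((g t)^T *m g t) b c) = cst ((1%:M : 'M[R]_p) b c).
  by apply/funext => t; rewrite og.
move=> /@derive_val; rewrite derive_cst => /esym /eqP; apply: etrans.
congr (_ == _); rewrite -big_split; apply: eq_bigr => i _ /=.
by rewrite !mxE addrC [V i b * _]mulrC.
Qed.

End OrthonormalCurves.

(** * Products with elementary matrices *)

Section DeltaMatrices.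
Variable R : comPzRingType.

Lemma mxtrace_mul_delta (m n : nat) (A : 'M[R]_(m, n)) i j :
  \tr (A *m delta_mx i j) = A j i.
Proof.
(* An elementary matrix is a column times a row; cyclicity leaves the trace of a 1 x 1 matrix. *)
rewrite -(mul_delta_mx (0 : 'I_1)) mulmxA mxtrace_mulC -colE -rowE.
by rewrite /mxtrace big_ord1 !mxE.
Qed.

Lemma delta_mulmx_delta (m n p q : nat) (A : 'M[R]_(n, p)) (i : 'I_m) a b
    (j : 'I_q) :
  delta_mx i a *m A *m delta_mx b j = A a b *: delta_mx i j.
Proof.
rewrite -(mul_delta_mx (0 : 'I_1) i) -(mul_delta_mx (0 : 'I_1) b) -!mulmxA.
rewrite (mulmxA A) -colE (mulmxA (delta_mx 0 a)) -rowE [row _ _]mx11_scalar.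
by rewrite mul_scalar_mx -scalemxAr mul_delta_mx !mxE.
Qed.

End DeltaMatrices.

(** * Criticality in terms of the gradient of the extension *)

Section CriticalPoints.
Variables (R : realType) (n p : nat).
Variables (Gt : stiefel R n p -> R) (G : 'rV[R]_(p * n) -> R).
Hypothesis hext : forall X : stiefel R n p, Gt X = G (vec (sval X)).
Implicit Types (U V B M : 'M[R]_(n, p)) (X : stiefel R n p).

(** The rotation curve starts at [X] with velocity [B], so the chain rule identifies this trace with
    a derivative that vanishes by criticality. *)
Lemma critical_point_rotation X B Q :
  differentiable G (vec (sval X)) -> critical_point Gt X ->
  Q^T = Q -> Q *m Q = Q -> B^T *m B = Q ->
  (B^T *m sval X)^T = - (B^T *m sval X) ->
  B^T *m sval X *m Q = B^T *m sval X ->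
  \tr ((gradmx G (vec (sval X)))^T *m B) = 0.
Proof.
move=> dG crit QT QQ BB KT KQ.
have XX : (sval X)^T *m sval X = 1%:M by apply/eqP/(svalP X).
pose gam t := cos t *: (sval X *m Q) + sin t *: B + sval X *m (1%:M - Q).
have gam_orth t : (gam t)^T *m gam t == 1%:M.
  by apply/eqP; exact: rotation_orthonormal.
pose g t : stiefel R n p := exist _ (gam t) (gam_orth t).
have vec_gam : (fun t => vec (sval (g t))) = fun t =>
    cos t *: vec (sval X *m Q) + sin t *: vec B + vec (sval X *m (1%:M - Q)).
  by apply/funext => t; rewrite /vec !linearD !linearZ.
have g0 : g 0 = X.
  apply: val_inj; rewrite /= /gam cos0 sin0 scale1r scale0r addr0 -mulmxDr.
  by rewrite addrC subrK mulmx1.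
have smg : smooth_on [set t : R | - 1 < t < 1] (fun t => vec (sval (g t))).
  by rewrite vec_gam; exact: smooth_trig_curve.
have := crit g 1 ltr01 smg g0.
have -> : (fun t => Gt (g t)) = G \o (fun t => vec (sval (g t))).
  by apply/funext => t; rewrite hext.
have dgam := is_diff_trig_curve (vec (sval X *m Q)) (vec B)
  (vec (sval X *m (1%:M - Q))) 0.
rewrite -vec_gam in dgam.
move=> /@derive_val; rewrite deriveE; last first.
  by apply: differentiable_comp => //; rewrite g0.
rewrite diff_comp ?g0 // diff_val /= cos0 sin0 scale0r subr0 !scale1r.
by rewrite diff_vec.
Qed.

Lemma critical_point_sym X : differentiable G (vec (sval X)) ->
  critical_point Gt X ->
  let S := (gradmx G (vec (sval X)))^T *m sval X in S^T = S.
Proof.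
move=> dG crit S; apply/matrixP => c b; rewrite mxE.
have [->//|bc] := eqVneq b c; have cb : c != b by rewrite eq_sym.
(* [J] generates the rotation in the coordinates [b] and [c], and [Q] projects onto them. The
   velocity [sval X *m J] sends column [b] towards column [c] and column [c] towards minus column
   [b]. *)
pose J : 'M[R]_p := delta_mx c b - delta_mx b c.
pose Q : 'M[R]_p := delta_mx b b + delta_mx c c.
have XX : (sval X)^T *m sval X = 1%:M by apply/eqP/(svalP X).
have JT : J^T = - J by rewrite /J linearB /= !trmx_delta opprB.
have QT : Q^T = Q by rewrite /Q linearD /= !trmx_delta.
have JQ : J *m Q = J.
  rewrite mulmxBl !mulmxDr !mul_delta_mx.
  by rewrite !mul_delta_mx_0 // ?addr0 ?add0r.
have JJ : J *m J = - Q.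
  rewrite mulmxBl !mulmxBr !mul_delta_mx.
  by rewrite !mul_delta_mx_0 // sub0r subr0 opprD addrC.
have QQ : Q *m Q = Q.
  rewrite mulmxDl !mulmxDr !mul_delta_mx.
  by rewrite !mul_delta_mx_0 // addr0 add0r.
have BX : (sval X *m J)^T *m sval X = - J.
  by rewrite trmx_mul -mulmxA XX mulmx1.
have : \tr ((gradmx G (vec (sval X)))^T *m (sval X *m J)) = 0.
  apply: (critical_point_rotation (Q := Q)) => //; rewrite ?BX.
  - by rewrite mulmxA BX mulNmx JJ opprK.
  - by rewrite linearN /= JT.
  - by rewrite mulNmx JQ.
rewrite mulmxA -/S mulmxBr raddfB /= => /eqP.
by rewrite !mxtrace_mul_delta subr_eq0 => /eqP ->.
Qed.

Lemma critical_point_range X : differentiable G (vec (sval X)) ->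
  critical_point Gt X ->
  let M := gradmx G (vec (sval X)) in M = sval X *m ((sval X)^T *m M).
Proof.
move=> dG crit M; set U := sval X.
have UU : U^T *m U = 1%:M by apply/eqP/(svalP X).
(* [W] is the part of [M] orthogonal to the columns of [U]; it has to vanish. *)
apply/eqP; rewrite -subr_eq0; apply/eqP; set W := _ - _.
have UW : U^T *m W = 0 by rewrite mulmxBr (mulmxA U^T U) UU mul1mx subrr.
have WU : W^T *m U = 0 by apply: trmx_inj; rewrite trmx_mul trmxK UW trmx0.
have MW : M^T *m W = W^T *m W.
  have -> : W^T = M^T - (U^T *m M)^T *m U^T by rewrite linearB /= !trmx_mul.
  by rewrite mulmxBl -[X in _ - X]mulmxA UW mulmx0 subr0.
have normW a : (W^T *m W) a a = \sum_i W i a ^+ 2.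
  by rewrite mxE; apply: eq_bigr => i _; rewrite mxE.
suff W0 a : (W^T *m W) a a = 0.
  apply/matrixP => i a; rewrite [RHS]mxE; apply/eqP; rewrite -sqrf_eq0.
  have /eqP := W0 a; rewrite normW psumr_eq0; last by move=> *; exact: sqr_ge0.
  by move=> /allP/(_ i); rewrite mem_index_enum => /(_ isT).
apply/eqP/negPn/negP => Waa.
set q := (W^T *m W) a a in Waa.
have q0 : 0 < q.
  rewrite lt_neqAle eq_sym Waa /q normW sumr_ge0 // => i _; exact: sqr_ge0.
pose k := (Num.sqrt q)^-1.
have k0 : k != 0 by rewrite invr_eq0 gt_eqF // sqrtr_gt0.
have kkq : k * k * q = 1.
  by rewrite -expr2 exprVn sqr_sqrtr ?ltW // mulVf.
(* Only column [a] moves, towards the column [a] of [W] scaled to norm 1 by [k]; hence [B^T *m B] is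
   [delta_mx a a]. *)
pose B : 'M[R]_(n, p) := k *: (W *m delta_mx a a).
have BT : B^T = k *: (delta_mx a a *m W^T).
  by rewrite linearZ /= trmx_mul trmx_delta.
have BU : B^T *m U = 0.
  by rewrite BT -scalemxAl -mulmxA WU mulmx0 scaler0.
have : \tr (M^T *m B) = 0.
  apply: (critical_point_rotation (Q := delta_mx a a)) => //.
  - by rewrite trmx_delta.
  - by rewrite mul_delta_mx.
  - rewrite BT -scalemxAl -scalemxAr scalerA.
    by rewrite mulmxA -(mulmxA _ _ W) delta_mulmx_delta scalerA kkq scale1r.
  - by rewrite BU trmx0 oppr0.
  - by rewrite BU mul0mx.
(* The trace equals [k * q], a product of nonzero factors. *)
rewrite -scalemxAr mulmxA MW linearZ /= mxtrace_mul_delta -/q => /eqP.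
by rewrite mulf_eq0 (negPf k0) (negPf Waa).
Qed.

Lemma critical_point_of_factor X (S : 'M[R]_p) :
  differentiable G (vec (sval X)) ->
  gradmx G (vec (sval X)) = sval X *m S -> S^T = S -> critical_point Gt X.
Proof.
move=> dG MS ST g e e0 smg g0.
have dgam : differentiable (fun t => vec (sval (g t))) 0.
  by have [+ _] := smg 1%N; apply; rewrite /= oppr_lt0 e0.
(* Every row vector is the [vec] of a matrix, so the velocity can be handled as a matrix [V]. *)
have [V VE] : exists V, 'D_1 (fun t => vec (sval (g t))) 0 = vec V.
  exists (vec_mx ('D_1 (fun t => vec (sval (g t))) 0))^T.
  by rewrite /vec trmxK vec_mxK.
have -> : (fun t => Gt (g t)) = G \o (fun t => vec (sval (g t))).
  by apply/funext => t; rewrite hext.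
have dGg : differentiable (G \o (fun t => vec (sval (g t)))) 0.
  by apply: differentiable_comp => //; rewrite g0.
apply: DeriveDef; first exact: diff_derivable.
rewrite deriveE // diff_comp ?g0 //= -(deriveE _ dgam) VE diff_vec // MS.
have : V^T *m sval X = - ((sval X)^T *m V).
  rewrite -g0; apply: (tangent_antisym (g := fun t => sval (g t))) => [t|].
    exact/eqP/(svalP (g t)).
  by rewrite -VE; apply: derivableP; exact: diff_derivable.
set K := (sval X)^T *m V => VX.
have KT : K^T = - K by rewrite trmx_mul trmxK.
rewrite trmx_mul ST -mulmxA -/K.
(* Transposition and cyclicity: [S] is symmetric and [K] antisymmetric. *)
have : \tr (S *m K) = - \tr (S *m K).
  by rewrite -[LHS]mxtrace_tr trmx_mul KT ST mulNmx linearN /= mxtrace_mulC.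
by move/eqP; rewrite -addr_eq0 -mulr2n mulrn_eq0 => /eqP.
Qed.

End CriticalPoints.

(** * Column spans, and the equivalence *)

Lemma span_colP (R : fieldType) (n p : nat) (U : 'M[R]_(n, p)) (x : 'cV[R]_n) :
  reflect (exists y, x = U *m y) (x \in <<[seq col b U | b : 'I_p]>>%VS).
Proof.
apply: (iffP idP) => [|[y ->]].
  (* Each column is the image under [U] of a basis vector, so the span lies in the image of
     [mulmx U]. *)
  have /subvP sub : (<<[seq col b U | b : 'I_p]>> <= limg (linfun (mulmx U)))%VS.
    apply/span_subvP => _ /mapP[b _ ->]; rewrite colE.
    have -> : U *m delta_mx b 0 = linfun (mulmx U) (delta_mx b 0 : 'cV_p).
      by rewrite lfunE.
    by rewrite memv_img // memvf.
  by move=> /sub /memv_imgP[y _ ->]; exists y; rewrite lfunE.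
rewrite [y]matrix_sum_delta linear_sum; apply: memv_suml => b _.
rewrite linear_sum; apply: memv_suml => j _.
rewrite linearZ (ord1 j) /= -colE memvZ // memv_span //.
by apply: map_f; rewrite mem_enum.
Qed.

Theorem theorem3p2 (R : realType) (n p : nat) (hp : (1 <= p)%N)
    (hpn : (p <= n)%N)
    (Gt : stiefel R n p -> R) (hGt : stiefel_smooth Gt)
    (G : 'rV[R]_(p * n) -> R) (hG : smooth_on setT G)
    (hext : forall X : stiefel R n p, Gt X = G (vec (sval X)))
    (U : 'M[R]_(n, p)) :
  (exists2 X : stiefel R n p, sval X = U & critical_point Gt X) <->
  [/\ forall b c : 'I_p, (b < c)%N ->
        inner (partial_col G c (vec U)) (col b U) =
        inner (partial_col G b (vec U)) (col c U),
      forall a : 'I_p,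
        partial_col G a (vec U) \in <<[seq col b U | b : 'I_p]>>%VS
    & U^T *m U = 1%:M].

Proof.
set M := gradmx G (vec U).
have innerE b c : inner (partial_col G b (vec U)) (col c U) = (M^T *m U) b c.
  by rewrite mxE; apply: eq_bigr => i _; rewrite !mxE.
have dG u : differentiable G u by have [+ _] := hG 1%N; apply.
split=> [[X XU crit]|[sym range UU]].
  subst U; split=> [b c _|a|]; last by apply/eqP/(svalP X).
    rewrite !innerE -(critical_point_sym hext (dG _) crit) mxE.
    by rewrite (critical_point_sym hext (dG _) crit).
  apply/span_colP; rewrite -col_gradmx -/M.
  rewrite [M](critical_point_range hext (dG _) crit) colE -mulmxA.
  by eexists.
have UU1 : U^T *m U == 1%:M by apply/eqP.
exists (exist _ U UU1 : stiefel R n p) => //.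
(* Condition (i) covers [b < c] only; exchanging the indices and the trivial diagonal case give full
   symmetry. *)
have symM b c : (M^T *m U) b c = (M^T *m U) c b.
  have [bc|cb|/val_inj ->//] := ltngtP b c; rewrite -!innerE.
    exact/esym/sym.
  exact: sym.
(* By (ii) each column of [M] is some [U *m y], which [U *m U^T] fixes by (iii); hence the factor
   [U^T *m M]. *)
apply: (critical_point_of_factor hext (S := U^T *m M)) => //=; last first.
  rewrite -[M in U^T *m M]trmxK -trmx_mul trmxK.
  by apply/matrixP => b c; rewrite [RHS]mxE symM.
apply/matrixP => i a.
have [y My] : exists y, col a M = U *m y.
  by rewrite col_gradmx; exact/span_colP.
have /colP/(_ i) : col a (U *m (U^T *m M)) = col a M.
  by rewrite colE -!mulmxA -colE My (mulmxA U^T) UU mul1mx.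
by rewrite !mxE.
Qed.
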